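(* Let $A\subset C$ be a finite ring extension of exponent one such that $C$ is a projective $A$-module. If $\mathrm{Der}_A(C)$ is a $C$-module direct summand of $\mathrm{End}_A(C)$, then $A\subset C$ is a Galois extension of exponent one.
   Context: All rings (except endomorphism algebras) are commutative with identity $1\neq 0$ and of characteristic $p$, for a fixed prime $p$. A ring extension $A\subset C$ is finite if $C$ is a finitely generated $A$-module; it is of exponent one if $x^p\in A$ for all $x\in C$. $\mathrm{End}_A(C)$ is the set of $A$-linear maps $C\to C$, a left $C$-module by $(c\cdot\varphi)(x)=c\,\varphi(x)$; $\mathrm{Der}_A(C)$ is the $C$-submodule of $A$-linear derivations $C\to C$. $p$-basis: for a ring extension $R\subset S$ of exponent one, elements $x_1,\ldots,x_n\in S$ form a $p$-basis for $S$ over $R$ if $S$ is a free $R$-module with basis the monomials $x_1^{\alpha_1}\cdots x_n^{\alpha_n}$, $0\le\alpha_i<p$ ($n=0$ allowed). Galois extension of exponent one: a finite ring extension $A\subset C$ of exponent one such that $C$ is a projective $A$-module and, for each prime ideal $\mathfrak p\subset A$, the extension $A_{\mathfrak p}\subset C_{\mathfrak p}:=C\otimes_A A_{\mathfrak p}$ admits a $p$-basis. *)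

(* Defs.v *)
From HB Require Import structures.
From mathcomp Require Import all_boot all_algebra.
From mathcomp Require Import boolp ring.

Set Implicit Arguments.
Unset Strict Implicit.
Unset Printing Implicit Defensive.

Import GRing.Theory.
Local Open Scope ring_scope.
Local Open Scope quotient_scope.

(* A ring extension A ⊂ C is a commutative A-algebra C whose structure map    *)
(* a |-> a%:A is injective.                                                   *)
Definition ring_extension (A : comNzRingType) (C : comAlgType A) : Prop :=
  injective (fun a : A => a%:A : C).

Definition module_finite (R : pzRingType) (M : lmodType R) : Prop :=
  exists n (g : 'I_n -> M), forall x, exists c : 'I_n -> R,
    x = \sum_i c i *: g i.

Definition projective (R : pzRingType) (Q : lmodType R) : Prop :=
  forall (M N : lmodType R) (g : {linear M -> N}) (f : {linear Q -> N}),
    (forall y, exists x, g x = y) ->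
    exists h : {linear Q -> M}, forall x, g (h x) = f x.

Definition exponent_one (p : nat) (A : comNzRingType) (C : comAlgType A) :
    Prop :=
  forall x : C, exists a : A, x ^+ p = a%:A.

Section Endomorphisms.
Variables (A : comNzRingType) (C : comAlgType A).

Definition endA : Type := {linear C -> C}.

Implicit Types (phi psi : endA) (c d x : C).

Lemma endAP phi psi : (phi : C -> C) =1 psi -> phi = psi.
Proof.
move=> /funext; case: phi psi => [f [[[f0 fD]] [fZ]]] [g [[[g0 gD]] [gZ]]] /= e.
case: g / e g0 gD gZ => g0 gD gZ.
by rewrite (Prop_irrelevance f0 g0) (Prop_irrelevance fD gD)
  (Prop_irrelevance fZ gZ).
Qed.

HB.instance Definition _ := gen_eqMixin endA.
HB.instance Definition _ := gen_choiceMixin endA.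

Definition endA0 : endA := \0.
Definition endA_opp phi : endA := \- phi.
Definition endA_add phi psi : endA := phi \+ psi.
Definition endA_scale c phi : endA := c \*o phi.

Fact endA_addA : associative endA_add.
Proof. by move=> f g h; apply: endAP => x /=; rewrite addrA. Qed.
Fact endA_addC : commutative endA_add.
Proof. by move=> f g; apply: endAP => x /=; rewrite addrC. Qed.
Fact endA_add0 : left_id endA0 endA_add.
Proof. by move=> f; apply: endAP => x /=; rewrite add0r. Qed.
Fact endA_addN : left_inverse endA0 endA_opp endA_add.
Proof. by move=> f; apply: endAP => x /=; rewrite addNr. Qed.

HB.instance Definition _ :=
  GRing.isZmodule.Build endA endA_addA endA_addC endA_add0 endA_addN.

Fact endA_scaleA c d phi :
  endA_scale c (endA_scale d phi) = endA_scale (c * d) phi.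
Proof. by apply: endAP => x /=; rewrite mulrA. Qed.
Fact endA_scale1 : left_id 1 endA_scale.
Proof. by move=> f; apply: endAP => x /=; rewrite mul1r. Qed.
Fact endA_scaleDr : right_distributive endA_scale +%R.
Proof. by move=> c f g; apply: endAP => x /=; rewrite mulrDr. Qed.
Fact endA_scaleDl phi : {morph endA_scale^~ phi : c d / c + d}.
Proof. by move=> c d; apply: endAP => x /=; rewrite mulrDl. Qed.

HB.instance Definition _ := GRing.Zmodule_isLmodule.Build C endA
  endA_scaleA endA_scale1 endA_scaleDr endA_scaleDl.

Lemma endA_zeroE x : (0 : endA) x = 0. Proof. by []. Qed.
Lemma endA_addE phi psi x : (phi + psi) x = phi x + psi x. Proof. by []. Qed.
Lemma endA_scaleE c phi x : (c *: phi) x = c * phi x. Proof. by []. Qed.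

Definition derA : {pred endA} :=
  [pred D : endA | `[< forall x y, D (x * y) = x * D y + y * D x >]].

Lemma derA_submod : submod_closed derA.
Proof.
split=> [|c D E]; rewrite !inE; first by apply/asboolP => x y /=; ring.
move=> /asboolP hD /asboolP hE; apply/asboolP => x y.
by rewrite !endA_addE !endA_scaleE hD hE; ring.
Qed.

End Endomorphisms.

Arguments endA {A} C.
Arguments derA {A} C.

Definition direct_summand (R : pzRingType) (M : lmodType R) (U : {pred M}) :
    Prop :=
  submod_closed U /\
  exists V : {pred M},
    [/\ submod_closed V,
        forall m, exists u v, [/\ u \in U, v \in V & m = u + v]
      & forall m, m \in U -> m \in V -> m = 0].

(* The localization C_P of an A-algebra C at a prime ideal P of A: fractions  *)
(* c/s with s in A \ P, where c/s = d/t iff u(tc - sd) = 0 for some u in      *)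
(* A \ P. The localization A_P of A itself is the case C := A^o. That C_P is  *)
(* C ⊗_A A_P is loc_tensorP below.                                            *)
Section Localization.
Variables (A : comNzRingType) (P : prime_idealr A) (C : comAlgType A).

Definition denom : Type := {s : A | s \notin P}.

Fact denom_subproof1 : 1 \notin P.
Proof. by rewrite idealr1. Qed.
Fact denom_subproofM (s t : denom) : val s * val t \notin P.
Proof. by rewrite prime_idealrM negb_or (valP s) (valP t). Qed.

Definition denom1 : denom :=
  exist (fun s : A => s \notin P) 1 denom_subproof1.
Definition denomM (s t : denom) : denom :=
  exist (fun s : A => s \notin P) _ (denom_subproofM s t).

Definition loc_rel (x y : C * denom) : bool :=
  `[< exists u : denom,
        val u *: (val y.2 *: x.1 - val x.2 *: y.1) = 0 >].

Fact loc_rel_refl : reflexive loc_rel.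
Proof. by move=> x; apply/asboolP; exists denom1; rewrite subrr scaler0. Qed.

Fact loc_rel_sym : symmetric loc_rel.
Proof.
move=> x y; apply: asbool_equiv_eq; split=> -[u hu]; exists u;
  by rewrite -opprB scalerN hu oppr0.
Qed.

Let algE (a : A) (c : C) : a *: c = in_alg C a * c.
Proof. by rewrite /= mulr_algl. Qed.

Fact loc_rel_trans : transitive loc_rel.
Proof.
move=> [d t] [c s] [e r] /asboolP[u /= hu] /asboolP[v /= hv]; apply/asboolP.
exists (denomM t (denomM u v)) => /=.
transitivity ((val v * val r) *: (val u *: (val t *: c - val s *: d)) +
  (val u * val s) *: (val v *: (val r *: d - val t *: e))).
  by rewrite !algE; ring.
by rewrite hu hv !scaler0 addr0.
Qed.

Canonical loc_equiv := EquivRel loc_rel loc_rel_refl loc_rel_sym loc_rel_trans.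

Definition loc : Type := {eq_quot loc_rel}.
HB.instance Definition _ := Choice.on loc.
HB.instance Definition _ : EqQuotient _ loc_rel loc := EqQuotient.on loc.

Definition loc_frac (c : C) (s : denom) : loc := \pi_loc (c, s).

Lemma loc_fracP c s d t :
  loc_frac c s = loc_frac d t <->
  exists u : denom, val u *: (val t *: c - val s *: d) = 0.
Proof.
rewrite /loc_frac; split=> [/eqmodP/asboolP //|h].
by apply/eqmodP/asboolP.
Qed.

Definition loc_num (x : loc) : C := (repr x).1.
Definition loc_den (x : loc) : denom := (repr x).2.

Lemma loc_numden x : loc_frac (loc_num x) (loc_den x) = x.
Proof. by rewrite /loc_frac -surjective_pairing reprK. Qed.

Lemma loc_ind (Q : loc -> Prop) : (forall c s, Q (loc_frac c s)) -> forall x, Q x.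
Proof. by move=> h x; rewrite -(loc_numden x). Qed.

Lemma loc_frac_numden c s : exists u : denom,
  val u *: (val s *: loc_num (loc_frac c s)
            - val (loc_den (loc_frac c s)) *: c) = 0.
Proof. by apply/loc_fracP; rewrite loc_numden. Qed.

Definition loc_add (x y : loc) : loc :=
  loc_frac (val (loc_den y) *: loc_num x + val (loc_den x) *: loc_num y)
           (denomM (loc_den x) (loc_den y)).
Definition loc_opp (x : loc) : loc := loc_frac (- loc_num x) (loc_den x).
Definition loc_mul (x y : loc) : loc :=
  loc_frac (loc_num x * loc_num y) (denomM (loc_den x) (loc_den y)).

Lemma loc_addE c s d t : loc_add (loc_frac c s) (loc_frac d t) =
  loc_frac (val t *: c + val s *: d) (denomM s t).
Proof.
rewrite /loc_add; have [u] := loc_frac_numden c s.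
have [v] := loc_frac_numden d t.
move: (loc_num _) (loc_den _) (loc_num _) (loc_den _) => c' s' d' t' hd hc.
apply/loc_fracP; exists (denomM u v) => /=.
transitivity ((val v * val t * val t') *: (val u *: (val s *: c' - val s' *: c))
  + (val u * val s * val s') *: (val v *: (val t *: d' - val t' *: d))).
  by rewrite !algE; ring.
by rewrite hc hd !scaler0 addr0.
Qed.

Lemma loc_oppE c s : loc_opp (loc_frac c s) = loc_frac (- c) s.
Proof.
rewrite /loc_opp; have [u hu] := loc_frac_numden c s.
apply/loc_fracP; exists u.
by rewrite !scalerN -opprD scalerN hu oppr0.
Qed.

Lemma loc_mulE c s d t :
  loc_mul (loc_frac c s) (loc_frac d t) = loc_frac (c * d) (denomM s t).
Proof.
rewrite /loc_mul; have [u] := loc_frac_numden c s.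
have [v] := loc_frac_numden d t.
move: (loc_num _) (loc_den _) (loc_num _) (loc_den _) => c' s' d' t' hd hc.
apply/loc_fracP; exists (denomM u v) => /=.
transitivity (val v *: (val t *: d') * (val u *: (val s *: c' - val s' *: c))
  + (val u *: (val s' *: c)) * (val v *: (val t *: d' - val t' *: d))).
  by rewrite !algE; ring.
by rewrite hc hd !mulr0 addr0.
Qed.

Lemma loc_frac_eq c s d t :
  val t *: c = val s *: d -> loc_frac c s = loc_frac d t.
Proof. by move=> e; apply/loc_fracP; exists denom1; rewrite e subrr scaler0. Qed.

Fact loc_addA : associative loc_add.
Proof.
elim/loc_ind=> c s; elim/loc_ind=> d t; elim/loc_ind=> e r.
by rewrite !loc_addE; apply: loc_frac_eq; rewrite /= !algE; ring.
Qed.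
Fact loc_addC : commutative loc_add.
Proof.
elim/loc_ind=> c s; elim/loc_ind=> d t.
by rewrite !loc_addE; apply: loc_frac_eq; rewrite /= !algE; ring.
Qed.
Fact loc_add0 : left_id (loc_frac 0 denom1) loc_add.
Proof.
elim/loc_ind=> c s.
by rewrite !loc_addE; apply: loc_frac_eq; rewrite /= !algE; ring.
Qed.
Fact loc_addN : left_inverse (loc_frac 0 denom1) loc_opp loc_add.
Proof.
elim/loc_ind=> c s.
by rewrite loc_oppE !loc_addE; apply: loc_frac_eq; rewrite /= !algE; ring.
Qed.

HB.instance Definition _ :=
  GRing.isZmodule.Build loc loc_addA loc_addC loc_add0 loc_addN.

Fact loc_mulA : associative loc_mul.
Proof.
elim/loc_ind=> c s; elim/loc_ind=> d t; elim/loc_ind=> e r.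
by rewrite !loc_mulE; apply: loc_frac_eq; rewrite /= !algE; ring.
Qed.
Fact loc_mulC : commutative loc_mul.
Proof.
elim/loc_ind=> c s; elim/loc_ind=> d t.
by rewrite !loc_mulE; apply: loc_frac_eq; rewrite /= !algE; ring.
Qed.
Fact loc_mul1 : left_id (loc_frac 1 denom1) loc_mul.
Proof.
elim/loc_ind=> c s.
by rewrite !loc_mulE; apply: loc_frac_eq; rewrite /= !algE; ring.
Qed.
Fact loc_mulDl : left_distributive loc_mul loc_add.
Proof.
elim/loc_ind=> c s; elim/loc_ind=> d t; elim/loc_ind=> e r.
by rewrite !(loc_addE, loc_mulE); apply: loc_frac_eq; rewrite /= !algE; ring.
Qed.

HB.instance Definition _ := GRing.Zmodule_isComPzRing.Build loc
  loc_mulA loc_mulC loc_mul1 loc_mulDl.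

Lemma loc_zeroE : (0 : loc) = loc_frac 0 denom1. Proof. by []. Qed.
Lemma loc_oneE : (1 : loc) = loc_frac 1 denom1. Proof. by []. Qed.
Lemma loc_fracD c s d t : loc_frac c s + loc_frac d t =
  loc_frac (val t *: c + val s *: d) (denomM s t).
Proof. exact: loc_addE. Qed.
Lemma loc_fracN c s : - loc_frac c s = loc_frac (- c) s.
Proof. exact: loc_oppE. Qed.
Lemma loc_fracM c s d t :
  loc_frac c s * loc_frac d t = loc_frac (c * d) (denomM s t).
Proof. exact: loc_mulE. Qed.

Definition loc_inj (c : C) : loc := loc_frac c denom1.

Fact loc_inj_zmod_morphism : zmod_morphism loc_inj.
Proof.
move=> c d; rewrite /loc_inj loc_fracN loc_fracD.
by apply: loc_frac_eq; rewrite /= !algE; ring.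
Qed.
Fact loc_inj_monoid_morphism : monoid_morphism loc_inj.
Proof.
split=> // c d; rewrite /loc_inj loc_fracM.
by apply: loc_frac_eq; rewrite /= !algE; ring.
Qed.
HB.instance Definition _ :=
  GRing.isZmodMorphism.Build C loc loc_inj loc_inj_zmod_morphism.
HB.instance Definition _ :=
  GRing.isMonoidMorphism.Build C loc loc_inj loc_inj_monoid_morphism.

End Localization.

Section LocalizationMap.
Variables (A : comNzRingType) (P : prime_idealr A) (C : comAlgType A).

Let algE (a : A) (c : C) : a *: c = in_alg C a * c.
Proof. by rewrite /= mulr_algl. Qed.

(* The ring morphism A_P -> C_P, a/s |-> a%:A/s (see loc_mapE).               *)
Definition loc_map (x : loc P A^o) : loc P C :=
  loc_frac ((loc_num x : A)%:A : C) (loc_den x).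

Lemma loc_mapE (a : A) (s : denom P) :
  loc_map (loc_frac (a : A^o) s) = loc_frac (a%:A : C) s.
Proof.
rewrite /loc_map; have [u hu] := loc_frac_numden (a : A^o) s.
apply/loc_fracP; exists u; rewrite !scalerA -scalerBl scalerA.
by rewrite [X in X *: _](hu : _ = 0 :> A) scale0r.
Qed.

Fact loc_map_zmod_morphism : zmod_morphism loc_map.
Proof.
elim/loc_ind=> a s; elim/loc_ind=> b t.
rewrite loc_fracN loc_fracD !loc_mapE loc_fracN loc_fracD.
apply: loc_frac_eq; congr (_ *: _).
by rewrite !scalerN !scalerA -scalerBl; congr (_ *: _).
Qed.
Fact loc_map_monoid_morphism : monoid_morphism loc_map.
Proof.
split; first by rewrite loc_oneE loc_mapE scale1r.
elim/loc_ind=> a s; elim/loc_ind=> b t.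
rewrite [X in loc_map X]loc_fracM !loc_mapE loc_fracM; apply: loc_frac_eq; congr (_ *: _).
exact: (rmorphM (in_alg C)).
Qed.
HB.instance Definition _ := GRing.isZmodMorphism.Build (loc P A^o) (loc P C)
  loc_map loc_map_zmod_morphism.
HB.instance Definition _ := GRing.isMonoidMorphism.Build (loc P A^o) (loc P C)
  loc_map loc_map_monoid_morphism.

(* C_P, with C × A_P -> C_P, (c, b) |-> c/1 * loc_map b, is the tensor        *)
(* product C ⊗_A A_P: this map is A-balanced (loc_map_alg) and universal      *)
(* among the A-balanced biadditive maps to abelian groups. Since loc_inj and  *)
(* loc_map are ring morphisms, this also identifies the ring structures.      *)
Lemma loc_map_alg (a : A) : loc_map (loc_inj P (a : A^o)) = loc_inj P (a%:A : C).
Proof. exact: loc_mapE. Qed.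

Lemma loc_tensorP (M : zmodType) (f : C -> loc P A^o -> M) :
    (forall c d b, f (c + d) b = f c b + f d b) ->
    (forall c b b', f c (b + b') = f c b + f c b') ->
    (forall a c b, f (a *: c) b = f c (loc_inj P (a : A^o) * b)) ->
  exists2 g : {additive loc P C -> M},
    (forall c b, g (loc_inj P c * loc_map b) = f c b)
    & forall g' : {additive loc P C -> M},
        (forall c b, g' (loc_inj P c * loc_map b) = f c b) -> g' =1 g.
Proof.
move=> fDl fDr fbal.
pose inv s : loc P A^o := loc_frac (1 : A^o) s.
pose g0 (x : loc P C) := f (loc_num x) (inv (loc_den x)).
have f0l b : f 0 b = 0 by apply: (addrI (f 0 b)); rewrite -fDl !addr0.
have fNl c b : f (- c) b = - f c b.
  by apply: (addrI (f c b)); rewrite -fDl !subrr f0l.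
have invM a s t : inv s = loc_inj P (a : A^o) * inv t
    <-> exists u : denom P, val u * (val t - val s * a) = 0.
  have -> : loc_inj P (a : A^o) * inv t = loc_frac (a : A^o) t.
    rewrite loc_fracM mulr1; apply: loc_frac_eq => /=; congr (_ * _).
    by rewrite mul1r.
  rewrite loc_fracP; split=> -[u hu]; exists u.
    by move: hu; rewrite /GRing.scale/= mulr1.
  by rewrite /GRing.scale/= mulr1.
have finv a s t c : val t = val s * a -> f c (inv s) = f (a *: c) (inv t).
  move=> e; rewrite fbal; congr (f c _); apply/invM.
  by exists (denom1 P); rewrite e subrr mulr0.
have g0E c s : g0 (loc_frac c s) = f c (inv s).
  rewrite /g0; have [u] := loc_frac_numden c s.
  move: (loc_num _) (loc_den _) => d t hu.
  rewrite (finv (val u * val s) t (denomM u (denomM s t))); last by rewrite /=; ring.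
  rewrite (finv (val u * val t) s (denomM u (denomM s t))); last by rewrite /=; ring.
  congr (f _ _); apply/eqP; rewrite -subr_eq0; apply/eqP.
  by rewrite -!scalerA -scalerBr.
have g0B : zmod_morphism g0.
  elim/loc_ind=> c s; elim/loc_ind=> d t.
  rewrite loc_fracN loc_fracD !g0E fDl scalerN fNl.
  by rewrite -(finv (val t) s) // -(finv (val s) t) //= mulrC.
pose gM := GRing.isZmodMorphism.Build _ _ g0 g0B.
pose g : {additive loc P C -> M} := HB.pack g0 gM.
have fracE (c : C) a s : loc_inj P c * loc_frac (a%:A : C) s = loc_frac (a *: c) s.
  rewrite loc_fracM; apply: loc_frac_eq => /=.
  by rewrite mulr_algr mul1r.
exists g.
  move=> c; elim/loc_ind=> a s; rewrite loc_mapE fracE /= g0E fbal.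
  congr (f c _); rewrite loc_fracM; apply: loc_frac_eq => /=.
  by rewrite mul1r mulr1.
move=> g' hg'; elim/loc_ind=> c s; rewrite /= g0E -hg' loc_mapE fracE.
by rewrite scale1r.
Qed.

Lemma loc_map_inj : ring_extension C -> injective loc_map.
Proof.
move=> inj; elim/loc_ind=> a s; elim/loc_ind=> b t; rewrite !loc_mapE.
move=> /loc_fracP[u hu]; apply/loc_fracP; exists u; apply: inj.
by rewrite scale0r -[RHS]hu !scalerA -scalerBl scalerA.
Qed.

Lemma loc_exponent_one p : exponent_one p C ->
  forall x : loc P C, exists b, x ^+ p = loc_map b.
Proof.
move=> hp; elim/loc_ind=> c s; have [a ha] := hp c.
have [t ht] : exists t, loc_frac c s ^+ p = loc_frac (c ^+ p) t.
  elim: p {hp ha} => [|p [t ht]]; first by exists (denom1 P).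
  by exists (denomM s t); rewrite exprS ht loc_fracM -exprS.
by exists (loc_frac (a : A^o) t); rewrite ht ha loc_mapE.
Qed.

End LocalizationMap.

Definition p_basis (p : nat) (R S : comPzRingType) (i : {rmorphism R -> S})
    (n : nat) (x : 'I_n -> S) : Prop :=
  forall y : S, exists! c : {ffun {ffun 'I_n -> 'I_p} -> R},
    y = \sum_alpha i (c alpha) * \prod_j x j ^+ alpha j.

Definition admits_p_basis (p : nat) (R S : comPzRingType)
    (i : {rmorphism R -> S}) : Prop :=
  exists n (x : 'I_n -> S), p_basis p i x.

Definition galois_exponent_one (p : nat) (A : comNzRingType)
    (C : comAlgType A) : Prop :=
  [/\ ring_extension C, module_finite C, exponent_one p C, projective C
    & forall P : prime_idealr A,
        admits_p_basis p (@loc_map A P C : {rmorphism loc P A^o -> loc P C})].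

(* Main.v *)
Require Import Defs.
From HB Require Import structures.
From mathcomp Require Import all_boot all_algebra.
From mathcomp Require Import boolp ring zify.

Set Implicit Arguments.
Unset Strict Implicit.
Unset Printing Implicit Defensive.

Import GRing.Theory.
Local Open Scope ring_scope.

(* Let phi_k, g_k be a dual basis of the projective A-module C. Projecting    *)
(* the phi_k to Der_A(C) gives derivations E_k with D = sum_k D(g_k) E_k for  *)
(* every D in Der_A(C), a property that survives localization at a prime P.   *)
(* Put R = A_P and S = C_P, which is local. Choose a maximal family of        *)
(* derivations D_j and elements x_j among the g_k with D_i(x_j) = delta_ij;   *)
(* by Nakayama's lemma a derivation killing all the x_j is zero.              *)
(* Every R-linear endomorphism of S is a differential operator, because       *)
(* ad(a)^p = ad(a^p) = 0. By descent on the order, an endomorphism commuting  *)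
(* with all the x_j is therefore a multiplication.                            *)
(* Let f : S -> R be R-linear with f(1) = 1, and let tau be the composite of  *)
(* +-f with D_1^(p-1) ... D_r^(p-1). Then tau(x^(p-1-b) x^a) = delta_ab, and  *)
(* z |-> sum_a tau(x^(p-1-a) z) x^a commutes with the x_j and maps 1 to 1, so *)
(* it is the identity: the x_j form a p-basis.                                *)

(** * Operators relative to an extension of exponent one *)

(** The summand hypothesis acts through one identity: an endomorphism is a [C]-combination of the
    coordinate functions of a dual basis, and projecting these to the derivations writes every
    derivation in terms of finitely many [E k] ([summand_derivations]), also after localization
    ([rder_loc_gen]). Over the local ring [S] this yields elements [x j] with dual derivations, such
    that only the zero derivation kills all [x j] ([exists_dual_family]). An endomorphism commuting
    with these elements is then a multiplication ([centralized_nil]), which forces the expansion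
    [expand_monom]; applying each dual derivation p - 1 times isolates single coefficients, whence
    uniqueness ([p_basis_of_dual]). *)

Section RelativeOperators.
Variables (R S : comPzRingType) (i : {rmorphism R -> S}).

Definition rlinear (phi : S -> S) : Prop :=
  {morph phi : x y / x + y} /\ forall a x, phi (i a * x) = i a * phi x.

Definition rder (D : S -> S) : Prop :=
  rlinear D /\ forall x y, D (x * y) = x * D y + y * D x.

Definition ad (a : S) (phi : S -> S) (z : S) : S := phi (a * z) - a * phi z.

Lemma rlinear0 phi : rlinear phi -> phi 0 = 0.
Proof. by case=> _ h; have := h 0 0; rewrite rmorph0 !mul0r. Qed.

Lemma rlinear_sum phi (I : Type) (r : seq I) (Q : pred I) (F : I -> S) :
  rlinear phi -> phi (\sum_(j <- r | Q j) F j) = \sum_(j <- r | Q j) phi (F j).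
Proof. by move=> h; apply: big_morph; [case: h | apply: rlinear0]. Qed.

Lemma rder_scale c D : rder D -> rder (fun z => c * D z).
Proof.
move=> [[DD DZ] DM]; split; first split.
- by move=> x y; rewrite DD mulrDr.
- by move=> a x; rewrite DZ mulrCA.
- by move=> x y; rewrite DM; ring.
Qed.

Lemma rder_sub D E : rder D -> rder E -> rder (fun z => D z - E z).
Proof.
move=> [[DD DZ] DM] [[ED EZ] EM]; split; first split.
- by move=> x y; rewrite DD ED; ring.
- by move=> a x; rewrite DZ EZ; ring.
- by move=> x y; rewrite DM EM; ring.
Qed.

Lemma rder_sum (I : Type) (r : seq I) (E : I -> S -> S) :
  (forall k, rder (E k)) -> rder (fun z => \sum_(k <- r) E k z).
Proof.
move=> hE; split; first split.
- move=> x y; rewrite -big_split; apply: eq_bigr => k _.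
  by have [[-> _] _] := hE k.
- move=> a x; rewrite mulr_sumr; apply: eq_bigr => k _.
  by have [[_ ->] _] := hE k.
- move=> x y; rewrite !mulr_sumr -big_split; apply: eq_bigr => k _.
  by have [_ ->] := hE k.
Qed.

Lemma rder1 D : rder D -> D 1 = 0.
Proof.
case=> _ /(_ 1 1)/eqP.
by rewrite !mul1r -subr_eq0 opprD addNKr oppr_eq0 => /eqP.
Qed.

Lemma rder_exp D x m : rder D -> D x = 0 -> D (x ^+ m) = 0.
Proof.
move=> hD Dx; elim: m => [|m IH]; first exact: rder1.
by rewrite exprS; have [_ ->] := hD; rewrite IH Dx !mulr0 addr0.
Qed.

Lemma rder_prod D (I : Type) (r : seq I) (Q : pred I) (F : I -> S) : rder D ->
  (forall j, Q j -> D (F j) = 0) -> D (\prod_(j <- r | Q j) F j) = 0.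
Proof.
move=> hD hF; apply: (big_ind (fun z => D z = 0)) => //; first exact: rder1.
by move=> x y Dx Dy; have [_ ->] := hD; rewrite Dx Dy !mulr0 addr0.
Qed.

Lemma rlinear_ad a phi : rlinear phi -> rlinear (ad a phi).
Proof.
case=> phiD phiZ; split; first by move=> x y; rewrite /ad mulrDr !phiD; ring.
by move=> b x; rewrite /ad mulrCA !phiZ; ring.
Qed.

Lemma ad_comm a b phi z : ad a (ad b phi) z = ad b (ad a phi) z.
Proof. by rewrite /ad [a * (b * z)]mulrCA; ring. Qed.

Lemma eq_ad a phi psi : phi =1 psi -> ad a phi =1 ad a psi.
Proof. by move=> e z; rewrite /ad !e. Qed.

(** Binomial formula: [ad a] is the difference of two commuting operators, multiplication by [a]
    before and after [phi]. *)
Lemma iter_adE a phi k z : rlinear phi -> iter k (ad a) phi z =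
  \sum_(j < k.+1) ((- a) ^+ j * phi (a ^+ (k - j) * z)) *+ 'C(k, j).
Proof.
move=> hphi; elim: k z => [|k IH] z.
  by rewrite big_ord1 /= !expr0 !mul1r mulr1n.
rewrite /= /ad !IH mulr_sumr big_ord_recl [in RHS]big_ord_recl.
rewrite [X in _ - X]big_ord_recr [\sum_(j < k.+1) _ in RHS]big_ord_recr.
rewrite !bin0 !binn !subnn !subn0 /= !expr0 mulrA -exprSr -!addrA.
congr (_ + _).
rewrite opprD addrA -sumrN -big_split; congr (_ + _).
  apply: eq_bigr => j _.
  rewrite /bump /= add1n binS mulrnDr; congr (_ + _).
    by rewrite mulrA -exprSr -subSn // ltn_ord.
  by rewrite subSS mulrnAr -mulNrn exprS !mulNr mulrA.
by rewrite /bump /= add1n mulr1n exprS mulrA !mulNr.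
Qed.

Variables (p : nat) (p_pr : prime p) (pS : p%:R = 0 :> S).

Lemma mulrn_dvd (x : S) m : (p %| m)%N -> x *+ m = 0.
Proof. by case/dvdnP=> q ->; rewrite -mulr_natr natrM pS !mulr0. Qed.

Lemma exprNp (x : S) : (- x) ^+ p = - x ^+ p.
Proof.
rewrite exprNn -signr_odd; have [p2|->] := even_prime p_pr; last first.
  by rewrite expr1 mulN1r.
rewrite p2 /= expr0 mul1r; apply/eqP; rewrite -addr_eq0 -mulr2n -{2}p2.
by rewrite mulrn_dvd.
Qed.

Hypothesis expS : forall x : S, exists a : R, x ^+ p = i a.

(** In characteristic p only the two extreme binomial terms survive, and they cancel since [a ^+ p]
    comes from [R] and [phi] is [R]-linear. *)
Lemma iter_ad0 a phi z : rlinear phi -> iter p (ad a) phi z = 0.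
Proof.
move=> hphi; rewrite (iter_adE _ _ _ hphi) big_ord_recl /=.
case: p p_pr exprNp expS mulrn_dvd => // q q_pr hN hE hM.
rewrite big_ord_recr big1 /= => [|j _]; last first.
  by rewrite hM // prime_dvd_bin //= /bump /= add1n ltnS ltn_ord.
rewrite bin0 /bump /= add1n binn subn0 subnn !expr0 !mul1r add0r !mulr1n hN.
by have [b ->] := hE a; have [_ ->] := hphi; rewrite mulNr subrr.
Qed.

(** * Endomorphisms commuting with elements that detect derivations *)

Section Centralizer.
Variables (r : nat) (x : 'I_r -> S).
Hypothesis derK : forall D, rder D -> (forall j, D (x j) = 0) ->
  forall z, D z = 0.

(** The list [l] holds further elements that [phi] must commute with. It starts as a generating
    family of [S] and is emptied one element at a time. *)
Definition centralized (l : seq S) : Prop := forall phi, rlinear phi ->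
  (forall j z, ad (x j) phi z = 0) ->
  (forall a, a \in l -> forall z, ad a phi z = 0) ->
  forall z, phi z = z * phi 1.

(* Since [ad a] is nilpotent, one may assume [ad a (ad a phi) = 0]; then all  *)
(* [ad b phi] are multiplications, so that [phi - phi 1] is a derivation and  *)
(* vanishes by [derK].                                                        *)
Lemma centralized_cons a l : centralized (a :: l) -> centralized l.
Proof.
move=> hal; suff H k : forall phi, rlinear phi ->
    (forall j z, ad (x j) phi z = 0) ->
    (forall b, b \in l -> forall z, ad b phi z = 0) ->
    (forall z, iter k.+1 (ad a) phi z = 0) -> forall z, ad a phi z = 0.
  move=> phi h1 h2 h3; apply: hal => // b.
  rewrite inE => /predU1P[->|]; last exact: h3.
  apply: (H p.-1) => // z; rewrite prednK ?prime_gt0 //; exact: iter_ad0.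
elim: k => // k IH phi h1 h2 h3 h4.
have com b c : (forall z, ad b phi z = 0) -> forall z, ad b (ad c phi) z = 0.
  by move=> h z; rewrite ad_comm (eq_ad _ h) /ad mulr0 subrr.
have ha : forall z, ad a (ad a phi) z = 0.
  apply: IH; first exact: rlinear_ad.
  - by move=> j; apply: com.
  - by move=> b /h3; apply: com.
  - by move=> z; rewrite -iterSr.
have hmul b z : ad b phi z = z * ad b phi 1.
  apply: (hal (ad b phi)); first exact: rlinear_ad.
  - by move=> j; apply: com.
  move=> c; rewrite inE => /predU1P[->|/h3]; last exact: com.
  move=> {}z; rewrite ad_comm.
  have e : ad a phi =1 fun z => z * ad a phi 1.
    apply: hal; first exact: rlinear_ad.
    + by move=> j; apply: com.
    + by move=> d; rewrite inE => /predU1P[->|/h3]; [exact: ha | exact: com].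
  by rewrite (eq_ad _ e) /ad mulrA subrr.
(* Expanded, [hmul u v] reads phi(uv) - u phi(v) = v (phi(u) - u phi(1)), which is the Leibniz rule
   for this map. *)
have hD : rder (fun z => phi z - z * phi 1).
  have [phiD phiZ] := h1; split; first split.
  - by move=> u v; rewrite phiD; ring.
  - by move=> b u; rewrite phiZ; ring.
  move=> u v; have := hmul u v; rewrite /ad mulr1 => /eqP.
  by rewrite subr_eq => /eqP ->; ring.
have phiE z : phi z = z * phi 1.
  apply/eqP; rewrite -subr_eq0; apply/eqP; apply: (derK hD) => j.
  by have := h2 j 1; rewrite /ad mulr1.
by move=> z; rewrite /ad phiE [phi z]phiE; ring.
Qed.

Variables (n : nat) (g : 'I_n -> S).
Hypothesis gen : forall y, exists c : 'I_n -> R, y = \sum_k i (c k) * g k.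

Lemma centralized_nil : centralized [::].
Proof.
have: centralized (codom g).
  move=> phi h1 _ h z; have [c ->] := gen z.
  rewrite (rlinear_sum _ _ _ h1) mulr_suml; apply: eq_bigr => k _.
  have [_ ->] := h1; rewrite -mulrA; congr (_ * _); apply/eqP.
  by have /eqP := h (g k) (codom_f g k) 1; rewrite /ad mulr1 subr_eq0.
by elim: (codom g) => // a l IH /centralized_cons.
Qed.

End Centralizer.

(** * Monomials in the [x j] and the functional pairing them *)

Section DualBasis.
Variables (r : nat) (x : 'I_r -> S) (D : 'I_r -> S -> S).
Hypotheses (derD : forall j, rder (D j))
  (dual : forall j k, D j (x k) = (j == k)%:R).

Lemma iter_der D0 y z m k : rder D0 -> D0 y = 1 -> D0 z = 0 ->
  iter k D0 (y ^+ m * z) = (m ^_ k)%:R * y ^+ (m - k) * z.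
Proof.
move=> [[D0D D0Z] D0M] D0y D0z.
have D00 : D0 0 = 0 by apply: rlinear0; split.
have Dn n u : D0 (n%:R * u) = n%:R * D0 u by rewrite -(rmorph_nat i) D0Z.
have Dx n : D0 (y ^+ n) = n%:R * y ^+ n.-1.
  elim: n => [|n IH]; first by rewrite (rder1 (conj (conj D0D D0Z) D0M)) mul0r.
  rewrite exprS D0M IH D0y mulr1 /= -natr1 mulrDl mul1r; congr (_ + _).
  by case: n {IH} => [|n] /=; rewrite ?mul0r ?mulr0 // mulrCA -exprS.
elim: k => [|k IH] /=; first by rewrite ffactn0 subn0 mul1r.
rewrite IH -mulrA Dn D0M D0z mulr0 add0r Dx ffactnSr natrM subnS.
by ring.
Qed.

(** When [s] lists all indices, this extracts, up to sign, the coefficient of the monomial with all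
    exponents p - 1 from a combination of monomials with exponents below p. *)
Definition top_der (s : seq 'I_r) (z : S) : S :=
  foldr (fun j => iter p.-1 (D j)) z s.

Lemma top_der_monom (s : seq 'I_r) (m : 'I_r -> nat) : uniq s ->
  top_der s (\prod_j x j ^+ m j) =
  \prod_j (if j \in s then (m j ^_ p.-1)%:R * x j ^+ (m j - p.-1)
           else x j ^+ m j).
Proof.
elim: s => [|l s IH] /= => [_|/andP[lns us]]; first by apply: eq_bigr.
rewrite IH // (bigD1 l) //= (negbTE lns) (iter_der _ _ (derD l)).
- rewrite [RHS](bigD1 l) //= mem_head; congr (_ * _); apply: eq_bigr => j jl.
  by rewrite inE (negbTE jl).
- by rewrite dual eqxx.
- apply: rder_prod => // j jl.
  have Dx n : D l (x j ^+ n) = 0.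
    by apply: rder_exp => //; rewrite dual eq_sym (negbTE jl).
  case: ifP => _; last exact: Dx.
  by rewrite -(rmorph_nat i); have [[_ ->] _] := derD l; rewrite Dx mulr0.
Qed.

Lemma rlinear_iter phi k : rlinear phi -> rlinear (iter k phi).
Proof.
move=> [hD hZ]; elim: k => [|k [ID IZ]] //=; split.
  by move=> y z /=; rewrite ID hD.
by move=> a z /=; rewrite IZ hZ.
Qed.

Lemma rlinear_top_der s : rlinear (top_der s).
Proof.
elim: s => [|j s [ID IZ]] //=.
have [hD hZ] : rlinear (iter p.-1 (D j)).
  by apply: rlinear_iter; have [] := derD j.
by split=> [y z|a z] /=; rewrite ?ID ?hD ?IZ ?hZ.
Qed.

Lemma prime_dvd_fact m : (p %| m`!)%N -> (p <= m)%N.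
Proof.
elim: m => [|m IH]; first by rewrite fact0 dvdn1 gtn_eqF ?prime_gt1.
by rewrite factS Euclid_dvdM // => /orP[/dvdn_leq-> //|/IH/leqW].
Qed.

(** The prime divides m! but not (m - (p - 1))!, because m - (p - 1) < p. *)
Lemma prime_dvd_ffact m : (p <= m)%N -> (m < p + p.-1)%N -> (p %| m ^_ p.-1)%N.
Proof.
move=> pm mp; have p1m : (p.-1 <= m)%N by apply: leq_trans pm; apply: leq_pred.
have : (p %| m ^_ p.-1 * (m - p.-1)`!)%N.
  by rewrite ffact_fact ?dvdn_fact ?prime_gt0.
rewrite Euclid_dvdM // => /orP[//|/prime_dvd_fact].
by rewrite leqNgt ltn_subLR // addnC mp.
Qed.

Definition monom (alpha : {ffun 'I_r -> 'I_p}) : S := \prod_j x j ^+ alpha j.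

(* The exponents [p - 1 - alpha j]: [monom (corev alpha)] is dual to          *)
(* [monom alpha] for [cotrace].                                               *)
Definition corev (alpha : {ffun 'I_r -> 'I_p}) : {ffun 'I_r -> 'I_p} :=
  [ffun j => rev_ord (alpha j)].

Lemma monomD1 j alpha :
  monom alpha = x j ^+ alpha j * \prod_(k | k != j) x k ^+ alpha k.
Proof. by rewrite /monom (bigD1 j). Qed.

(** The exponent of [x j] in the product is p - 1 - beta j + alpha j. If it equals p - 1, the factor
    is (p - 1)! = -1; if it is smaller, the falling factorial is 0; if it is larger, it lies between
    p and 2p - 2 and [prime_dvd_ffact] applies. *)
Lemma top_der_monomM alpha beta :
  top_der (enum 'I_r) (monom (corev beta) * monom alpha) =
  (-1) ^+ r *+ (alpha == beta).
Proof.
have p0 := prime_gt0 p_pr.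
rewrite /monom -big_split /=.
rewrite (eq_bigr (fun j => x j ^+ (corev beta j + alpha j))); last first.
  by move=> j _; rewrite exprD.
rewrite top_der_monom ?enum_uniq //.
have [->|neq] := eqVneq alpha beta.
  rewrite (eq_bigr (fun=> -1)) ?prodr_const ?card_ord // => j _.
  have -> : (corev beta j + beta j = p.-1)%N.
    by rewrite ffunE /=; have := ltn_ord (beta j); lia.
  rewrite mem_enum subnn ffactnn expr0 mulr1; apply/eqP.
  rewrite -addr_eq0 natr1.
  by rewrite mulrn_dvd // -Wilson ?prime_gt1.
have [j aj] : exists j, alpha j != beta j.
  apply/existsP; apply: contraR neq => /existsPn h.
  by apply/eqP/ffunP => j; apply/eqP/negPn.
rewrite (bigD1 j) //= mem_enum.
suff -> : ((corev beta j + alpha j) ^_ p.-1)%:R = 0 :> S by rewrite !mul0r.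
rewrite ffunE /=; have := ltn_ord (beta j); have := ltn_ord (alpha j).
move: aj; rewrite -val_eqE /= => aj ap bp.
have [lt|ge] := ltnP (p - (beta j).+1 + alpha j) p.-1;
  first by rewrite ffact_small.
by rewrite mulrn_dvd // prime_dvd_ffact //; lia.
Qed.

Variables (f : S -> R).
Hypotheses (fD : {morph f : y z / y + z})
  (fZ : forall a y, f (i a * y) = a * f y) (f1 : f 1 = 1).

(* The sign compensates [(p - 1)! = -1] (Wilson), once for each variable. *)
Definition cotrace (z : S) : R := f ((-1) ^+ r * top_der (enum 'I_r) z).

Lemma cotraceD : {morph cotrace : y z / y + z}.
Proof.
move=> y z; have [h _] := rlinear_top_der (enum 'I_r).
by rewrite /cotrace h mulrDr fD.
Qed.

Lemma cotraceZ a z : cotrace (i a * z) = a * cotrace z.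
Proof.
by have [_ h] := rlinear_top_der (enum 'I_r); rewrite /cotrace h mulrCA fZ.
Qed.

Lemma cotrace_monom alpha beta :
  cotrace (monom (corev beta) * monom alpha) = (alpha == beta)%:R.
Proof.
rewrite /cotrace top_der_monomM mulrnAr -expr2 sqrr_sign.
have f0 : f 0 = 0 by have := fZ 0 0; rewrite rmorph0 !mul0r.
by case: eqP => _; rewrite ?f1 ?f0.
Qed.

Hypothesis derK : forall D0, rder D0 -> (forall j, D0 (x j) = 0) ->
  forall z, D0 z = 0.
Variables (n : nat) (g : 'I_n -> S).
Hypothesis gen : forall y, exists c : 'I_n -> R, y = \sum_k i (c k) * g k.

Lemma expand_monom z :
  z = \sum_alpha i (cotrace (monom (corev alpha) * z)) * monom alpha.
Proof.
pose F z := \sum_alpha i (cotrace (monom (corev alpha) * z)) * monom alpha.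
have [p' p'E] : exists p', p = p'.+1 by exists p.-1; rewrite prednK ?prime_gt0.
have hF : rlinear F.
  split=> [y {}z|a {}z]; rewrite /F.
    rewrite -big_split; apply: eq_bigr => alpha _.
    by rewrite mulrDr cotraceD rmorphD mulrDl.
  rewrite mulr_sumr; apply: eq_bigr => alpha _.
  by rewrite mulrCA cotraceZ rmorphM mulrA.
have F1 : F 1 = 1.
  pose o : 'I_p := cast_ord (esym p'E) ord0.
  pose al0 : {ffun 'I_r -> 'I_p} := [ffun=> o].
  have m0 : monom al0 = 1 by apply: big1 => j _; rewrite ffunE expr0.
  have cot1 al : cotrace (monom (corev al) * 1) = (al0 == al)%:R.
    by rewrite -(cotrace_monom al0 al) m0.
  rewrite /F (bigD1 al0) //= cot1 eqxx m0 rmorph1 mulr1 big1 ?addr0 // =>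
    al alN.
  by rewrite cot1 eq_sym (negbTE alN) rmorph0 mul0r.
have hx j y : ad (x j) F y = 0.
  apply/eqP; rewrite subr_eq0; apply/eqP; rewrite /F mulr_sumr.
  (* Multiplication by [x j] shifts the [j]-th exponent cyclically, at the cost of [x j ^+ p] on
     wrapping around. The same factor [eps] appears for [monom al] and for the reversed monomial of
     [h al], so the two sums agree after reindexing by [h]. *)
  pose h (al : {ffun 'I_r -> 'I_p}) : {ffun 'I_r -> 'I_p} :=
    [ffun k => if k == j then ordS (al k) else al k].
  have h_inj : injective h.
    move=> al be /ffunP e; apply/ffunP => k; have := e k; rewrite !ffunE.
    by case: ifP => // _ /ordS_inj.
  rewrite (reindex_inj h_inj) /=; apply: eq_bigr => al _.
  have [a xa] := expS (x j).
  pose eps : R := if al j == p.-1 :> nat then a else 1.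
  have other (u v : {ffun 'I_r -> 'I_p}) : (forall k, k != j -> u k = v k) ->
      \prod_(k | k != j) x k ^+ u k = \prod_(k | k != j) x k ^+ v k.
    by move=> e; apply: eq_bigr => k /e ->.
  have xal : x j * monom al = i eps * monom (h al).
    rewrite !(monomD1 j) !mulrA (other al (h al)); last first.
      by move=> k kj; rewrite ffunE (negbTE kj).
    congr (_ * _); rewrite -exprS ffunE eqxx /eps /=.
    case: eqP => [e|ne].
      by rewrite e prednK ?prime_gt0 // modnn expr0 mulr1 xa.
    by rewrite modn_small ?rmorph1 ?mul1r //; have := ltn_ord (al j); lia.
  have xrev : x j * monom (corev (h al)) = i eps * monom (corev al).
    rewrite !(monomD1 j) !mulrA (other (corev (h al)) (corev al)); last first.
      by move=> k kj; rewrite !ffunE (negbTE kj).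
    congr (_ * _); rewrite -exprS !ffunE eqxx /eps /=.
    case: eqP => [e|ne].
      by rewrite e prednK ?prime_gt0 // modnn subnn expr0 mulr1 subn1 prednK
        ?prime_gt0.
    rewrite modn_small ?rmorph1 ?mul1r //; last by have := ltn_ord (al j); lia.
    by congr (_ ^+ _); have := ltn_ord (al j); lia.
  rewrite mulrA [_ * x j]mulrC xrev -mulrA cotraceZ rmorphM mulrCA.
  by rewrite mulrAC -xal; ring.
have cent := centralized_nil derK gen.
have : F z = z * F 1 by apply: (cent F hF hx).
by rewrite F1 mulr1 => /esym.
Qed.

Lemma p_basis_of_dual : p_basis p i x.
Proof.
move=> y; exists [ffun alpha => cotrace (monom (corev alpha) * y)]; split.
  by rewrite {1}[y]expand_monom; apply: eq_bigr => al _; rewrite ffunE.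
move=> c; rewrite -[RHS in y = RHS]/(\sum_al i (c al) * monom al) => yE.
apply/ffunP => be; rewrite ffunE yE mulr_sumr.
have cot0 : cotrace 0 = 0 by have := cotraceZ 0 0; rewrite rmorph0 !mul0r.
rewrite (big_morph _ cotraceD cot0) (bigD1 be) //= big1 ?addr0 => [|al alN].
  by rewrite mulrCA cotraceZ cotrace_monom eqxx mulr1.
by rewrite mulrCA cotraceZ cotrace_monom (negbTE alN) mulr0.
Qed.

End DualBasis.

(** * Derivations of a local ring *)

Definition invertible (u : S) : Prop := exists v, u * v = 1.

Section Local.
Hypotheses (S_nz : 1 <> 0 :> S)
  (S_loc : forall u v, invertible (u + v) -> invertible u \/ invertible v).

Lemma not_invertibleM u v : ~ invertible v -> ~ invertible (u * v).
Proof. by move=> hv [w uvw]; apply: hv; exists (u * w); rewrite -uvw; ring. Qed.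

(** Elimination: [1 - N ord0 ord0] is invertible by locality, so [v ord0] can be substituted away,
    and the smaller system still has non-invertible entries. *)
Lemma local_nakayama m (v : 'I_m -> S) (N : 'I_m -> 'I_m -> S) :
    (forall k l, ~ invertible (N k l)) ->
    (forall l, v l = \sum_k v k * N k l) -> forall l, v l = 0.
Proof.
elim: m v N => [|m IH] v N hN hv l; first by case: l.
have : invertible ((1 - N ord0 ord0) + N ord0 ord0).
  by exists 1; rewrite subrK mulr1.
case/S_loc=> [[w hw]|/hN//].
have v0 : v ord0 = \sum_(k < m) v (lift ord0 k) * (N (lift ord0 k) ord0 * w).
  have : v ord0 * (1 - N ord0 ord0) =
      \sum_(k < m) v (lift ord0 k) * N (lift ord0 k) ord0.
    by rewrite mulrBr mulr1 {1}hv big_ord_recl addrAC subrr add0r.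
  move=> /(congr1 ( *%R^~ w)); rewrite -mulrA hw mulr1 mulr_suml => ->.
  by apply: eq_bigr => k _; rewrite mulrA.
have vl : forall k, v (lift ord0 k) = 0.
  apply: (IH _ (fun k l => N (lift ord0 k) (lift ord0 l) +
                           N (lift ord0 k) ord0 * w * N ord0 (lift ord0 l))).
    by move=> k k' /S_loc[]; [exact: hN | exact/not_invertibleM/hN].
  move=> k; rewrite hv big_ord_recl v0 mulr_suml -big_split.
  by apply: eq_bigr => k' _ /=; ring.
have [k ->|->] := unliftP ord0 l => //.
by rewrite v0 big1 // => k _; rewrite vl mul0r.
Qed.

Variables (n : nat) (g : 'I_n -> S) (E : 'I_n -> S -> S).
Hypotheses (derE : forall k, rder (E k))
  (genE : forall D, rder D -> forall z, D z = \sum_k D (g k) * E k z).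

Definition dual_family r (h : 'I_r -> 'I_n) : Prop :=
  exists D : 'I_r -> S -> S, (forall j, rder (D j)) /\
    forall j k, D j (g (h k)) = (j == k)%:R.

Lemma dual_family_size r (h : 'I_r -> 'I_n) : dual_family h -> (r <= n)%N.
Proof.
case=> D [_ dual]; rewrite -[r]card_ord -[n]card_ord; apply: (leq_card h).
move=> j k e; have := dual j k; rewrite -e dual eqxx => /esym.
by case: eqP => // _ /esym/S_nz.
Qed.

Lemma exists_dual_family : exists r (h : 'I_r -> 'I_n), dual_family h /\
  forall D, rder D -> (forall j, D (g (h j)) = 0) -> forall z, D z = 0.
Proof.
pose Q r := `[< exists h : 'I_r -> 'I_n, dual_family h >].
have Q0 : exists r, Q r.
  exists 0%N; apply/asboolP; exists (widen_ord (leq0n n)), (fun _ _ => 0).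
  by split=> -[].
have Qn r : Q r -> (r <= n)%N by move=> /asboolP[h /dual_family_size].
have [r /asboolP[h hh] r_max] := ex_maxnP Q0 Qn.
exists r, h; split=> //; have [D [derD dual]] := hh.
(* Otherwise a multiple [D1] of [D0] takes the value 1 at [g l]; correcting each [D j] by a multiple
   of [D1] gives a longer dual family. *)
have small D0 : rder D0 -> (forall j, D0 (g (h j)) = 0) ->
    forall l, ~ invertible (D0 (g l)).
  move=> derD0 D0h l [w hw].
  suff /r_max : Q r.+1 by rewrite ltnn.
  pose D1 z := w * D0 z; have derD1 : rder D1 by apply: rder_scale.
  have D1l : D1 (g l) = 1 by rewrite /D1 mulrC.
  have D1h j : D1 (g (h j)) = 0 by rewrite /D1 D0h mulr0.
  apply/asboolP.
  exists (fun k => if unlift ord_max k is Some j then h j else l).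
  exists (fun k => if unlift ord_max k is Some j
    then fun z => D j z - D j (g l) * D1 z else D1); split.
    move=> k; case: unliftP => // j _.
    by apply: rder_sub => //; apply: rder_scale.
  move=> j k; case: (unliftP ord_max j) => [j'|] ->;
    case: (unliftP ord_max k) => [k'|] ->.
  - by rewrite dual D1h mulr0 subr0 (inj_eq lift_inj).
  - by rewrite D1l mulr1 subrr eq_sym (negbTE (neq_lift _ _)).
  - by rewrite D1h (negbTE (neq_lift _ _)).
  - by rewrite D1l eqxx.
move=> D0 derD0 D0h.
(* Subtracting the components along the [D j] makes [E' k] kill all [g (h j)]. By [small] the matrix
   of the [E' k (g l)] then has non-invertible entries, as Nakayama requires. *)
pose E' k z := E k z - \sum_j E k (g (h j)) * D j z.
have derE' k : rder (E' k).
  by apply: rder_sub => //; apply: rder_sum => j; apply: rder_scale.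
have E'h k j : E' k (g (h j)) = 0.
  rewrite /E' (bigD1 j) //= dual eqxx mulr1 big1 ?addr0 ?subrr // => j' j'j.
  by rewrite dual (negbTE j'j) mulr0.
have D0E z : D0 z = \sum_k D0 (g k) * E' k z.
  rewrite {1}(genE derD0) -[LHS]subr0.
  rewrite -[X in _ - X](_ :
    \sum_j (\sum_k D0 (g k) * E k (g (h j))) * D j z = 0).
    rewrite (eq_bigr (fun j => \sum_k D0 (g k) * (E k (g (h j)) * D j z)));
      last first.
      by move=> j _; rewrite mulr_suml; apply: eq_bigr => k _; rewrite mulrA.
    rewrite exchange_big -sumrB; apply: eq_bigr => k _.
    by rewrite -mulr_sumr -mulrBr.
  by rewrite big1 // => j _; rewrite -genE // D0h mul0r.
have D0g : forall l, D0 (g l) = 0.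
  apply: (local_nakayama (N := fun k l => E' k (g l))) => // k l.
  exact: small.
by move=> z; rewrite D0E big1 // => k _; rewrite D0g mul0r.
Qed.

End Local.
End RelativeOperators.

(** * Localization at a prime *)

Section LocalizedLinear.
Variables (A : comNzRingType) (P : prime_idealr A) (C : comAlgType A).
Local Notation R := (loc P A^o).
Local Notation S := (loc P C).
Local Notation iota := (@loc_map A P C : {rmorphism R -> S}).
Local Notation inj := (@loc_inj A P C).

Let algE (a : A) (c : C) : a *: c = in_alg C a * c.
Proof. by rewrite /= mulr_algl. Qed.

Lemma loc_injZ (a : A) (c : C) :
  inj (a *: c) = iota (loc_inj P (a : A^o)) * inj c.
Proof. by rewrite /= loc_map_alg -rmorphM mulr_algl. Qed.

Lemma loc_fracE (c : C) s : loc_frac c s = iota (loc_frac (1 : A^o) s) * inj c.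
Proof.
rewrite /= loc_mapE loc_fracM; apply: loc_frac_eq => /=.
by rewrite scale1r mul1r mulr1.
Qed.

Lemma loc_frac_den s : inj (val s)%:A * loc_frac (1 : C) s = 1.
Proof.
by rewrite loc_fracM loc_oneE; apply: loc_frac_eq;
  rewrite /= mulr1 mul1r scale1r.
Qed.

Lemma loc_frac_inj (c : C) s : loc_frac c s = inj c * loc_frac (1 : C) s.
Proof. by rewrite loc_fracM; apply: loc_frac_eq; rewrite /= mulr1 mul1r. Qed.

Lemma loc_inj_eq0 (c : C) : inj c = 0 -> exists u : denom P, val u *: c = 0.
Proof.
rewrite loc_zeroE => /loc_fracP[u]; rewrite scale1r scaler0 subr0.
by exists u.
Qed.

Lemma loc_common_denom (s : seq S) :
  exists t : denom P, forall y, y \in s -> exists d, y = loc_frac d t.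
Proof.
elim: s => [|y s [t IH]]; first by exists (denom1 P).
exists (denomM (loc_den y) t) => z; rewrite inE => /predU1P[->|/IH[d ->]].
  exists (val t *: loc_num y); rewrite -{1}[y]loc_numden.
  by apply: loc_frac_eq; rewrite /= scalerA.
by exists (val (loc_den y) *: d); apply: loc_frac_eq; rewrite /= scalerA mulrC.
Qed.

Lemma loc_common_ann (s : seq C) : (forall c, c \in s -> inj c = 0) ->
  exists u : denom P, forall c, c \in s -> val u *: c = 0.
Proof.
elim: s => [|c s IH] h; first by exists (denom1 P).
have [|u hu] := IH; first by move=> d ds; apply: h; rewrite inE ds orbT.
have [v hv] := loc_inj_eq0 (h c (mem_head _ _)).
exists (denomM u v) => d; rewrite inE /= => /predU1P[->|/hu ud].
  by rewrite -scalerA hv scaler0.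
by rewrite mulrC -scalerA ud scaler0.
Qed.

Section Map.
Variables (C' : comAlgType A) (phi : {linear C -> C'}).

Definition loc_lin (x : S) : loc P C' := loc_frac (phi (loc_num x)) (loc_den x).

Lemma loc_linE c s : loc_lin (loc_frac c s) = loc_frac (phi c) s.
Proof.
apply/loc_fracP; have [u hu] := loc_frac_numden c s; exists u.
by rewrite -!linearZ -linearB -linearZ /= hu linear0.
Qed.

Lemma loc_linD : {morph loc_lin : x y / x + y}.
Proof.
elim/loc_ind=> c s; elim/loc_ind=> d t.
by rewrite loc_fracD !loc_linE linearD !linearZ loc_fracD.
Qed.

Lemma loc_linZ a x : loc_lin (iota a * x) = (@loc_map A P C' a) * loc_lin x.
Proof.
elim/loc_ind: a => a s; elim/loc_ind: x => c t.
by rewrite /= !loc_mapE loc_fracM !loc_linE loc_fracM !mulr_algl linearZ.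
Qed.

End Map.

Lemma loc_lin_rder (D : endA C) : D \in derA C -> rder iota (loc_lin D).
Proof.
rewrite inE => /asboolP hD; split.
  by split; [exact: loc_linD | exact: loc_linZ].
elim/loc_ind=> c s; elim/loc_ind=> d t.
rewrite loc_fracM !loc_linE hD !loc_fracM loc_fracD; apply: loc_frac_eq.
by rewrite /= !algE; ring.
Qed.

(** * Derivations of the localization come from derivations of [C] *)

Section Derivations.
Variables (n : nat) (g : 'I_n -> C) (f : 'I_n -> {linear C -> A^o}).
Hypothesis gen : forall c, c = \sum_k (f k c : A) *: g k.

Lemma loc_inj_gen c :
  inj c = \sum_k iota (loc_inj P (f k c : A^o)) * inj (g k).
Proof.
by rewrite {1}[c]gen raddf_sum; apply: eq_bigr => k _; apply: loc_injZ.
Qed.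

Lemma loc_gen (y : S) : exists c : 'I_n -> R, y = \sum_k iota (c k) * inj (g k).
Proof.
elim/loc_ind: y => c s.
exists (fun k => loc_frac (1 : A^o) s * loc_inj P (f k c : A^o)).
rewrite loc_fracE loc_inj_gen mulr_sumr; apply: eq_bigr => k _.
by rewrite rmorphM mulrA.
Qed.

(** The values of [D] on the finitely many [g k] have a common denominator, and so do the finitely
    many relations needed for the Leibniz rule; clearing both gives [D1]. *)
Lemma rder_loc (D : S -> S) : rder iota D ->
  exists (D1 : endA C) e, D1 \in derA C /\ forall c, D (inj c) = inj (D1 c) * e.
Proof.
move=> hD; have [[DD DZ] DM] := hD.
have [t ht] := loc_common_denom (codom (fun k => D (inj (g k)))).
have [d hd] : exists d : 'I_n -> C, forall k, D (inj (g k)) = loc_frac (d k) t.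
  exact: (fin_all_exists (fun k => ht _ (codom_f _ k))).
pose ext (d : 'I_n -> C) c := \sum_k (f k c : A) *: d k.
have ext_lin d' : linear (ext d').
  move=> a b c; rewrite /ext scaler_sumr -big_split; apply: eq_bigr => k _.
  by rewrite linearP scalerDl scalerA.
pose extl d' : endA C :=
  HB.pack (ext d') (GRing.isLinear.Build _ _ _ _ _ (ext_lin d')).
have D0E c : D (inj c) = inj (ext d c) * loc_frac 1 t.
  rewrite loc_inj_gen (rlinear_sum _ _ _ (conj DD DZ)) raddf_sum mulr_suml.
  apply: eq_bigr => k _; rewrite DZ hd loc_frac_inj mulrA; congr (_ * _).
  by rewrite -loc_injZ.
have extD : {morph ext d : x y / x + y} := linearD (extl d).
have extZ a x : ext d (a *: x) = a *: ext d x := linearZ_LR (extl d) a x.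
(* The Leibniz defect of [ext d]. It is bilinear and vanishes in [S], where [ext d] is a multiple of
   [D], so one denominator [u] annihilates it on all pairs of generators. *)
pose lam c c' := ext d (c * c') - (c * ext d c' + c' * ext d c).
have lamC c c' : lam c c' = lam c' c.
  by rewrite /lam [c * c']mulrC [X in _ - X]addrC.
have lamD c : {morph lam c : x y / x + y}.
  by move=> x y; rewrite /lam mulrDr !extD; ring.
have lamZ c a x : lam c (a *: x) = a *: lam c x.
  rewrite /lam -scalerAr !extZ !scalerBr !scalerDr.
  by rewrite -scalerAr -scalerAl.
have injlam c c' : inj (lam c c') = 0.
  rewrite -[LHS]mulr1 -(loc_frac_den t) mulrCA; set w := loc_frac _ _.
  suff -> : inj (lam c c') * w = 0 by rewrite mulr0.
  rewrite /lam rmorphB rmorphD !rmorphM mulrBl mulrDl -!mulrA -!D0E rmorphM DM.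
  by rewrite subrr.
have [|u hu] := @loc_common_ann (codom (fun q => lam (g q.1) (g q.2))).
  by move=> _ /codomP[q ->].
have killed c : (forall k, val u *: lam c (g k) = 0) ->
    forall y, val u *: lam c y = 0.
  move=> h y; rewrite [y]gen; apply: (big_ind (fun y => val u *: lam c y = 0)).
  - by rewrite -[X in lam c X](scale0r (0 : C)) lamZ scale0r scaler0.
  - by move=> x z hx hz; rewrite lamD scalerDr hx hz addr0.
  - by move=> k _; rewrite lamZ scalerA mulrC -scalerA h scaler0.
have D1E c : extl (fun k => val u *: d k) c = val u *: ext d c.
  by rewrite /= /ext scaler_sumr; apply: eq_bigr => k _; rewrite !scalerA mulrC.
exists (extl (fun k => val u *: d k)), (loc_frac 1 u * loc_frac 1 t); split.
  rewrite inE; apply/asboolP => x y; rewrite !D1E -!scalerAr -scalerDr.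
  apply/eqP; rewrite -subr_eq0 -scalerBr; apply/eqP.
  apply: (killed x) => k; rewrite lamC; apply: killed => l.
  exact: hu (codom_f (fun q => lam (g q.1) (g q.2)) (k, l)).
by move=> c; rewrite D1E -mulr_algl rmorphM D0E mulrACA loc_frac_den mul1r.
Qed.

Variable E : 'I_n -> endA C.
Hypotheses (derE : forall k, E k \in derA C)
  (genE : forall D : endA C, D \in derA C ->
    forall c, D c = \sum_k D (g k) * E k c).

Lemma rder_loc_gen (D : S -> S) : rder iota D ->
  forall z, D z = \sum_k D (inj (g k)) * loc_lin (E k) z.
Proof.
move=> hD; have [[_ DZ] _] := hD; have [D1 [e [derD1 D1E]]] := rder_loc hD.
elim/loc_ind=> c s; rewrite loc_fracE DZ D1E genE // raddf_sum.
rewrite mulr_suml mulr_sumr.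
apply: eq_bigr => k _; have [[_ EZ] _] := loc_lin_rder (derE k).
rewrite EZ loc_linE -/(inj _) D1E -[X in _ * (X * e)]/(inj (D1 (g k) * E k c)).
by rewrite rmorphM; ring.
Qed.

End Derivations.

(** * Locality of [S] and the p-basis at a prime *)

Section LocalizedBasis.
Variable p : nat.
Hypotheses (pA : p \in [pchar A]) (AC : ring_extension C)
  (expC : exponent_one p C).

Lemma pchar_alg : p \in [pchar C].
Proof.
have /andP[p_pr /eqP pA0] := pA; apply/andP; split=> //; apply/eqP.
by rewrite -(rmorph_nat (in_alg C)) pA0 rmorph0.
Qed.

Lemma denomX (s : denom P) m : val s ^+ m \notin P.
Proof.
elim: m => [|m IH]; first exact: denom_subproof1.
by rewrite exprS prime_idealrM negb_or (valP s).
Qed.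

Lemma exprDp : {morph (fun c : C => c ^+ p) : c d / c + d}.
Proof.
by move=> c d; rewrite exprDn_pchar // pnatE ?pchar_alg //; have /andP[] := pA.
Qed.

(** For an inverse d/t, the p-th power of the relation between cd and st lies in [A]; if [a] were in
    [P], it would put a denominator in [P]. *)
Lemma loc_invertibleP c s a : c ^+ p = a%:A ->
  invertible (loc_frac c s : S) <-> a \notin P.
Proof.
move=> ca; split=> [[v]|aP].
  elim/loc_ind: v => d t; have [b db] := expC d.
  rewrite loc_fracM loc_oneE => /loc_fracP[u] /eqP.
  rewrite scale1r scalerBr subr_eq0 => /eqP/(congr1 (fun z => z ^+ p)).
  rewrite /= !exprZn exprMn ca db expr1n -scalerAl mul1r.
  rewrite !scalerA => /AC e; apply/negP => aP.
  have := denomX (denomM u (denomM s t)) p.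
  rewrite /= exprMn -e !prime_idealrM aP.
  by rewrite /= orbT.
exists (loc_frac (val s *: c ^+ p.-1) (exist _ a aP)).
rewrite loc_fracM loc_oneE; apply: loc_frac_eq.
rewrite /= scale1r -scalerAr -exprS prednK ?ca ?scalerA //.
by have /andP[/prime_gt0] := pA.
Qed.

(** Additivity of the p-th power transfers locality from [A] at [P] to [S]. *)
Lemma loc_local (u v : S) : invertible (u + v) -> invertible u \/ invertible v.
Proof.
elim/loc_ind: u => c s; elim/loc_ind: v => d t; rewrite loc_fracD.
have [a ca] := expC c; have [b db] := expC d.
have e : (val t *: c + val s *: d) ^+ p = (val t ^+ p * a + val s ^+ p * b)%:A.
  by rewrite exprDp !exprZn ca db scalerDl !scalerA.
rewrite (loc_invertibleP _ e) (loc_invertibleP _ ca) (loc_invertibleP _ db).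
move=> h; apply/orP; rewrite -negb_and; apply: contra h => /andP[aP bP].
by apply: rpredD; rewrite prime_idealrM ?aP ?bP orbT.
Qed.

Lemma loc_one_neq0 : 1 <> 0 :> S.
Proof.
move=> e; have [u] := loc_inj_eq0 (e : inj 1 = 0).
rewrite -(scale0r (1 : C)) => /AC u0.
by have := valP u; rewrite u0 /= rpred0.
Qed.

Variables (n : nat) (g : 'I_n -> C) (f : 'I_n -> {linear C -> A^o}).
Hypothesis gen : forall c, c = \sum_k (f k c : A) *: g k.

(** The p-th power of the expansion of 1 writes 1 as a combination in [A] of the p-th powers of the
    [f k 1], so these cannot all lie in [P]. *)
Lemma exists_coord_denom : exists k, (f k 1 : A) \notin P.
Proof.
have p_pr : prime p by have /andP[] := pA.
have [b gb] : exists b : 'I_n -> A, forall k, g k ^+ p = (b k)%:A.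
  exact: (fin_all_exists (fun k => expC (g k))).
have expr0p : 0 ^+ p = 0 :> C by rewrite expr0n gtn_eqF ?prime_gt0.
have e : \sum_k (f k 1 : A) ^+ p * b k = 1.
  apply: AC; rewrite scale1r -[RHS](expr1n _ p) [X in _ = X ^+ p]gen.
  rewrite (big_morph _ exprDp expr0p) scaler_suml.
  by apply: eq_bigr => k _; rewrite exprZn gb scalerA.
have : ~~ [forall k, (f k 1 : A) \in P].
  apply/negP => /forallP h; have /negP[] := denom_subproof1 P.
  rewrite -e; apply: rpred_sum => k _; rewrite prime_idealrM.
  by rewrite -(prednK (prime_gt0 p_pr)) exprS prime_idealrM h.
by rewrite negb_forall => /existsP.
Qed.

Variable E : 'I_n -> endA C.
Hypotheses (derE : forall k, E k \in derA C)
  (genE : forall D : endA C, D \in derA C ->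
    forall c, D c = \sum_k D (g k) * E k c).

Lemma loc_admits_p_basis : admits_p_basis p iota.
Proof.
have p_pr : prime p by have /andP[] := pA.
have pS : p%:R = 0 :> S.
  by rewrite -(rmorph_nat inj) (pcharf0 pchar_alg) rmorph0.
have [k0 k0P] := exists_coord_denom.
pose s0 : denom P := exist (fun s : A => s \notin P) _ k0P.
(* An [R]-linear retraction of [S] onto [R]: a coordinate function divided by its value at 1. *)
pose tr z : R := loc_lin (f k0) z * loc_frac (1 : A^o) s0.
have tr1 : tr 1 = 1.
  rewrite /tr loc_oneE loc_linE loc_fracM; apply: loc_frac_eq => /=.
  by rewrite /GRing.scale /= !mulr1 mul1r.
have trD : {morph tr : y z / y + z}.
  by move=> y z; rewrite /tr loc_linD mulrDl.
have trZ a y : tr (iota a * y) = a * tr y.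
  rewrite /tr loc_linZ mulrA; congr (_ * _ * _).
  by elim/loc_ind: a => a s; rewrite loc_mapE; congr loc_frac; exact: mulr1.
have [r [h [[D [derD dual]] derK]]] := exists_dual_family loc_one_neq0 loc_local
  (fun k => loc_lin_rder (derE k)) (rder_loc_gen gen derE genE).
exists r, (fun j => inj (g (h j))).
exact: (p_basis_of_dual p_pr pS (loc_exponent_one expC) derD dual trD trZ tr1
  derK (loc_gen gen)).
Qed.

End LocalizedBasis.
End LocalizedLinear.

(** * Dual bases and the splitting off of derivations *)

Section ProjectiveDualBasis.
Variables (A : comNzRingType) (C : comAlgType A).

Lemma projective_dual_basis : module_finite C -> projective C ->
  exists n (g : 'I_n -> C) (f : 'I_n -> {linear C -> A^o}),
    forall c, c = \sum_k (f k c : A) *: g k.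
Proof.
move=> [n [g gen]] projC.
pose ev (v : 'rV[A]_n) : C := \sum_k v 0 k *: g k.
have ev_lin : linear ev.
  move=> a u v; rewrite /ev scaler_sumr -big_split; apply: eq_bigr => k _.
  by rewrite !mxE scalerDl scalerA.
pose evl : {linear 'rV[A]_n -> C} :=
  HB.pack ev (GRing.isLinear.Build _ _ _ _ _ ev_lin).
have ev_surj c : exists v, evl v = c.
  have [w ->] := gen c; exists (\row_k w k).
  by apply: eq_bigr => k _; rewrite mxE.
(* Projectivity lifts the identity of [C] through the surjection from the free module; the
   coordinates of this section are the dual basis. *)
have [h hK] := projC _ _ evl idfun ev_surj.
pose f k (c : C) : A^o := h c 0 k.
have f_lin k : linear (f k) by move=> a c d; rewrite /f linearP !mxE.
pose fl k : {linear C -> A^o} :=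
  HB.pack (f k) (GRing.isLinear.Build _ _ _ _ _ (f_lin k)).
exists n, g, fl.
by move=> c; rewrite -{1}[c]/(idfun c) -hK.
Qed.

Lemma summand_derivations n (g : 'I_n -> C) (f : 'I_n -> {linear C -> A^o}) :
    (forall c, c = \sum_k (f k c : A) *: g k) -> direct_summand (derA C) ->
  exists E : 'I_n -> endA C, (forall k, E k \in derA C) /\
    forall D : endA C, D \in derA C -> forall c, D c = \sum_k D (g k) * E k c.
Proof.
move=> gen [_ [V [submodV split capV]]].
pose phi k (c : C) : C := (f k c : A)%:A.
have phi_lin k : linear (phi k).
  by move=> a c d; rewrite /phi linearP scalerDl scalerA.
pose phil k : endA C :=
  HB.pack (phi k) (GRing.isLinear.Build _ _ _ _ _ (phi_lin k)).
have [E hE] := fin_all_exists (fun k => split (phil k)).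
have [W hW] := fin_all_exists hE.
exists E; split=> [k|D derD c]; first by case: (hW k).
have [V0 VP] := submodV; have [D0 DP] := derA_submod C.
have memU (U : {pred endA C}) (F : 'I_n -> endA C) : submod_closed U ->
    (forall k, F k \in U) -> \sum_k D (g k) *: F k \in U.
  move=> [U0 UP] hF; apply: (big_ind (fun z => z \in U)) => // [x y hx hy|k _].
    by rewrite -[x]scale1r UP.
  by rewrite -[_ *: _]addr0 UP.
have DE : D = \sum_k D (g k) *: phil k.
  apply: endAP => z.
  have -> : (\sum_k D (g k) *: phil k) z = \sum_k D (g k) * phi k z.
    by apply: (big_morph (fun F : endA C => F z)).
  rewrite {1}[z]gen linear_sum; apply: eq_bigr => k _.
  by rewrite linearZ /= /phi -scalerAr mulr1.
(* The difference is a derivation and, by [DE], also a combination of the complementary components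
   [W k]; hence it lies in both summands. *)
have : D - \sum_k D (g k) *: E k = 0.
  apply: capV.
    rewrite -scaleN1r addrC DP //.
    by apply: memU (derA_submod C) _ => k; case: (hW k).
  rewrite {1}DE -sumrB (eq_bigr (fun k => D (g k) *: W k)); last first.
    by move=> k _; have [_ _ ->] := hW k; rewrite -scalerBr addrAC subrr add0r.
  by apply: memU submodV _ => k; case: (hW k).
move/eqP; rewrite subr_eq0 => /eqP/(congr1 (fun F : endA C => F c)) ->.
by apply: (big_morph (fun F : endA C => F c)).
Qed.

End ProjectiveDualBasis.

Theorem proposition3p23 (p : nat) (A : comNzRingType) (C : comAlgType A)
    (pA : p \in [pchar A]) (AC : ring_extension C) (finC : module_finite C)
    (expC : exponent_one p C) (projC : projective C)
    (sumC : direct_summand (derA C)) :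
  galois_exponent_one p C.
Proof.
split=> // P; have [n [g [f gen]]] := projective_dual_basis finC projC.
have [E [derE genE]] := summand_derivations gen sumC.
exact: (loc_admits_p_basis P pA AC expC gen derE genE).
Qed.
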